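(* Let $\mathcal A=(Q,\{a,b\},\delta)$ be an automaton in which $b$ acts as a permutation of $Q$ and $a$ is of type $[1,2]\backslash 1$, where $1,2$ are distinct states of $Q$. Then $\mathcal A$ is $3$-compressible (and proper) if and only if all of the following conditions hold: (1) $|Orb_b(1)|\ge 2$ and $\{1,2\}b\ne\{1,2\}$; (2) for every state $3\in Q\setminus\{1,2\}$: if $b=(13)\pi$, then (a) $3a\ne 3$, and (b) if $3a=2$, then $2b\ne 2$ or $2a\ne 3$, and (c) if $3a=2b$ and $2b\notin\{2,3\}$, then $2b^2\ne 2$ or $2ba\ne 3$; (3) for every state $3\in Q\setminus\{1,2\}$: if $b=(123)\pi$ or $b=(132)\pi$, then $\{2,3\}a\ne\{2,3\}$; (4) for all distinct states $3,4\in Q\setminus\{1,2\}$: if $b=(1324)\pi$, then $\{3,4\}a\ne\{3,4\}$. Moreover, if $\mathcal A$ is $3$-compressible (and proper), then at least one of the words $ababa$, $aba^2ba$, $ab^2ab^2a$, $ab^2a^2b^2a$, $ab^2abab^2a$, $abab^2aba$, $ab^3aba$, $abab^3a$, $ab^3ab^3a$ $3$-compresses $\mathcal A$.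
   Context: A (semi)automaton is $\mathcal A=(Q,\Sigma,\delta)$ with $Q$ a finite set of states, $\Sigma=\{a,b\}$, and $\delta:Q\times\Sigma\to Q$ total. Words act on states from the right, letter by letter from left to right: $qw$ is the state reached from $q$ by reading $w$ (so $2ba=(2b)a$); for $S\subseteq Q$, $Sw=\{qw:q\in S\}$. A word $w$ $3$-compresses $\mathcal A$ if $|Q|-|Qw|\ge 3$; $\mathcal A$ is $3$-compressible if some word $3$-compresses it. A $3$-compressible automaton is proper if no word of length $3$ $3$-compresses it. The letter $a$ is of type $[1,2]\backslash 1$ if $1a=2a$, no other two distinct states have the same image under $a$, and $Q\setminus Qa=\{1\}$. $Orb_b(q)=\{qb^n:n\ge 0\}$. Permutations are written in disjoint cycle notation: $b=(13)\pi$ means $1b=3$, $3b=1$, and $\pi$ is an arbitrary permutation of the remaining states $Q\setminus\{1,3\}$; similarly $b=(123)\pi$ means $1b=2$, $2b=3$, $3b=1$; $b=(132)\pi$ means $1b=3$, $3b=2$, $2b=1$; $b=(1324)\pi$ means $1b=3$, $3b=2$, $2b=4$, $4b=1$; in each case $\pi$ is an arbitrary permutation of the states not displayed. States are denoted by numerals and different numerals denote different states; the numerals $3,4$ are names for arbitrary states other than $1,2$. *)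

(* Defs.v *)
From HB Require Import structures.
From mathcomp Require Import all_boot.

Set Implicit Arguments.
Unset Strict Implicit.
Unset Printing Implicit Defensive.

Inductive letter := La | Lb.

Definition bool_of_letter (l : letter) : bool := if l is La then true else false.
Definition letter_of_bool (x : bool) : letter := if x then La else Lb.
Lemma bool_of_letterK : cancel bool_of_letter letter_of_bool.
Proof. by case. Qed.
HB.instance Definition _ := Finite.copy letter (can_type bool_of_letterK).

Definition word := seq letter.

Record automaton := Automaton {
  state : finType;
  delta : state -> letter -> state
}.

Definition acta (A : automaton) (q : state A) : state A := delta q La.
Definition actb (A : automaton) (q : state A) : state A := delta q Lb.

(* Words act on the right and are read from left to right. *)
Definition act (A : automaton) (q : state A) (w : word) : state A :=
  foldl (@delta A) q w.

Definition act_set (A : automaton) (S : {set state A}) (w : word)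
    : {set state A} :=
  [set act q w | q in S].

(* The subtraction is never truncated, since #|Qw| <= #|Q|. *)
Definition compresses3 (A : automaton) (w : word) : Prop :=
  3 <= #|state A| - #|act_set [set: state A] w|.

Definition compressible3 (A : automaton) : Prop :=
  exists w : word, compresses3 A w.

Definition proper_compressible3 (A : automaton) : Prop :=
  compressible3 A /\ forall w : word, size w = 3 -> ~ compresses3 A w.

(* Type [p,q]\r: p and q are merged, no other pair is, and r is missed. *)
Definition a_of_type (A : automaton) (p q r : state A) : Prop :=
  [/\ acta p = acta q,
      forall x y : state A,
        x != y -> acta x = acta y -> [set x; y] = [set p; q]
    & ~: [set acta x | x : state A] = [set r]].

(* When b is a permutation, [b_cycle [:: x1; ...; xn]] for distinct xi says
   that (x1 ... xn) is one of the disjoint cycles of b, i.e.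
   b = (x1 ... xn)pi with pi a permutation of the other states. *)
Definition b_cycle (A : automaton) (c : seq (state A)) : Prop :=
  fcycle (@actb A) c.

Section Conditions.

Variables (A : automaton) (s1 s2 : state A).

Let a := @acta A.
Let b := @actb A.

Definition condition1 : Prop :=
  2 <= #|orbit b s1| /\ act_set [set s1; s2] [:: Lb] <> [set s1; s2].

Definition condition2 : Prop :=
  forall s3 : state A, s3 \notin [set s1; s2] -> b_cycle [:: s1; s3] ->
  [/\ a s3 <> s3,
      a s3 = s2 -> b s2 <> s2 \/ a s2 <> s3
    & a s3 = b s2 -> b s2 \notin [set s2; s3] ->
      b (b s2) <> s2 \/ a (b s2) <> s3].

Definition condition3 : Prop :=
  forall s3 : state A, s3 \notin [set s1; s2] ->
  b_cycle [:: s1; s2; s3] \/ b_cycle [:: s1; s3; s2] ->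
  act_set [set s2; s3] [:: La] <> [set s2; s3].

Definition condition4 : Prop :=
  forall s3 s4 : state A,
  s3 \notin [set s1; s2] -> s4 \notin [set s1; s2] -> s3 <> s4 ->
  b_cycle [:: s1; s3; s2; s4] ->
  act_set [set s3; s4] [:: La] <> [set s3; s4].

End Conditions.

Definition short_words : seq word :=
  [:: [:: La; Lb; La; Lb; La];
      [:: La; Lb; La; La; Lb; La];
      [:: La; Lb; Lb; La; Lb; Lb; La];
      [:: La; Lb; Lb; La; La; Lb; Lb; La];
      [:: La; Lb; Lb; La; Lb; La; Lb; Lb; La];
      [:: La; Lb; La; Lb; Lb; La; Lb; La];
      [:: La; Lb; Lb; Lb; La; Lb; La];
      [:: La; Lb; La; Lb; Lb; Lb; La];
      [:: La; Lb; Lb; Lb; La; Lb; Lb; Lb; La]].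

Definition some_short_word_compresses3 (A : automaton) : Prop :=
  exists2 w : word, w \in short_words & compresses3 A w.

(* Main.v *)
Require Import Defs.
From mathcomp Require Import all_boot.

Set Implicit Arguments.
Unset Strict Implicit.
Unset Printing Implicit Defensive.

(** Call the states outside [Qw] the holes of [w].  Reading [b] permutes the
holes.  Reading [a] always makes [s1] a hole; it moves the other holes along
[a], except that a hole at [s1] or [s2] disappears, unless both are holes, in
which case [a s1 = a s2] becomes one.  Hence a new hole appears exactly when
neither [s1] nor [s2] is a hole, and the automaton is 3-compressible precisely
when some word has two holes, both outside [{s1, s2}]: then [a] makes a third.

Necessity of the conditions ([trapped] and the lemmas [compressible3_condition*])
then asks, whenever a condition fails, for a family of pairs of states, each
meeting [{s1, s2}], that the moves of the holes cannot leave.  The holes stay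
inside a pair of the family forever, so there are never three of them.

Sufficiency ([stuck_near], [stuck_far]) follows a few pairs of holes by hand.
Right after an [a] two holes have the form [{s1, y}].  If no listed word makes
three holes, then for each listed word that ends in [b^k a], with [{s1, y}] the
holes before this suffix and [b^k s1] outside [{s1, s2}], the state [b^k y] must
lie in [{s1, s2}].  Since [b] is injective this leaves two values for [y]; since
[a] is injective outside [s1], different words compete for these two values, and
the only ways to share them are the configurations that the conditions exclude.
As [b s1 <> s1] by [condition1], either [b s1 = s2] (the near case) or [b s1] is
outside [{s1, s2}] (the far case).

Properness is automatic: each letter [a] adds at most one hole, and [aaa] has
the single hole [s1] ([compresses3_size3]). *)

Section Automaton.

Variables (A : automaton) (s1 s2 : state A).
Hypotheses (s1_neq_s2 : s1 <> s2) (b_perm : bijective (@actb A)).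
Hypothesis a_type : a_of_type s1 s2 s1.

Local Notation a := (@acta A).
Local Notation b := (@actb A).

(** * The two letters *)

Lemma actb_inj : injective b.
Proof. exact: bij_inj b_perm. Qed.

Lemma acta_s1 : a s1 = a s2.
Proof. by case: a_type. Qed.

Lemma acta_neq_s1 x : a x <> s1.
Proof.
case: a_type => _ _ img ax1.
have: s1 \in ~: [set a z | z : state A] by rewrite img set11.
by rewrite inE -ax1 imset_f.
Qed.

Lemma acta_inj x y : x <> s1 -> y <> s1 -> a x = a y -> x = y.
Proof.
case: a_type => _ inj _ x1 y1 axy; apply/eqP/idPn => nxy.
have: s1 \in [set x; y] by rewrite (inj x y) ?set21.
by rewrite !inE => /orP[] /eqP/esym.
Qed.

(** The preimage can be taken different from [s1], because [s2] has the same
image as [s1]. *)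
Lemma acta_surj x : x <> s1 -> exists2 y, y <> s1 & x = a y.
Proof.
case: a_type => _ _ img x1.
have: x \notin ~: [set a z | z : state A] by rewrite img inE; apply/eqP.
rewrite inE negbK => /imsetP[y _ ->].
have [->|/eqP y1] := eqVneq y s1; last by exists y.
by exists s2; [exact: nesym | exact: acta_s1].
Qed.

(** * How the letters move the holes *)

Definition hole (w : word) (x : state A) : bool :=
  x \notin act_set [set: state A] w.

Lemma act_set_rcons (S : {set state A}) w l :
  act_set S (rcons w l) = [set delta x l | x in act_set S w].
Proof.
rewrite /act_set -imset_comp; apply: eq_imset => x.
by rewrite /act -cats1 foldl_cat.
Qed.

Lemma card_act_set_cat (S : {set state A}) w v :
  #|act_set S (w ++ v)| <= #|act_set S w|.
Proof.
elim/last_ind: v => [|v l IHv]; first by rewrite cats0.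
by rewrite -rcons_cat act_set_rcons (leq_trans (leq_imset_card _ _)).
Qed.

Lemma compresses3_cat w v : compresses3 A w -> compresses3 A (w ++ v).
Proof.
by move/leq_trans; apply; rewrite leq_sub2l // card_act_set_cat.
Qed.

Lemma compresses3_holes w : compresses3 A w <-> 3 <= #|[set x | hole w x]|.
Proof.
rewrite /compresses3 -cardsT -cardsDS ?subsetT // setTD.
by rewrite (_ : [set x | _] = ~: act_set [set: state A] w) //;
  apply/setP => x; rewrite !inE.
Qed.

Lemma hole_preimage w l x : hole (rcons w l) (delta x l) -> hole w x.
Proof.
by rewrite /hole act_set_rcons; apply: contra => wx; apply/imsetP; exists x.
Qed.

Lemma hole_nil x : hole [::] x = false.
Proof. by apply/negbTE; rewrite negbK; apply/imsetP; exists x. Qed.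

Lemma hole_b w x : hole w x -> hole (rcons w Lb) (b x).
Proof.
by rewrite /hole act_set_rcons mem_imset //; apply: actb_inj.
Qed.

Lemma hole_s1 w : hole (rcons w La) s1.
Proof.
rewrite /hole act_set_rcons; apply/imsetP => -[x _ /esym].
exact: acta_neq_s1.
Qed.

Lemma hole_a w y : hole w y -> y <> s1 -> y <> s2 -> hole (rcons w La) (a y).
Proof.
rewrite /hole act_set_rcons => hy y1 y2; apply/imsetP => -[x wx].
have [-> | /eqP x1] := eqVneq x s1.
  by rewrite -/(a s1) acta_s1 => /acta_inj eqy; case: y2; apply: eqy => // /esym.
by move/(acta_inj y1 x1) => eqyx; rewrite eqyx wx in hy.
Qed.

(** Both preimages of [a s2] under [a] are holes, hence so is [a s2]: this is how
two holes survive at the merged states. *)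
Lemma hole_a_merged w : hole w s1 -> hole w s2 -> hole (rcons w La) (a s2).
Proof.
rewrite /hole act_set_rcons => h1 h2; apply/imsetP => -[x wx].
have [x1 | /eqP x1] := eqVneq x s1; first by rewrite -x1 wx in h1.
move/(acta_inj (nesym s1_neq_s2) x1) => x2.
by rewrite x2 wx in h2.
Qed.

(** * Pairs of holes and three holes *)

Definition hole_pair (w : word) (x y : state A) : Prop :=
  [/\ x <> y, hole w x & hole w y].

Lemma hole_pairC w x y : hole_pair w x y -> hole_pair w y x.
Proof. by case=> /nesym. Qed.

Lemma hole_pair_b w x y : hole_pair w x y -> hole_pair (rcons w Lb) (b x) (b y).
Proof. by case=> xy hx hy; split; [move/actb_inj | apply: hole_b..]. Qed.

Lemma hole_pair_start w x :
  hole w x -> x <> s1 -> x <> s2 -> hole_pair (rcons w La) s1 (a x).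
Proof.
move=> hx x1 x2; split; [exact/nesym/acta_neq_s1|exact: hole_s1|exact: hole_a].
Qed.

(** A hole [x] in [{s1, s2}] is replaced by the new hole [s1], and [y] moves to
[a y].  This holds for [y] in [{s1, s2}] too: then [{x, y} = {s1, s2}] and
[hole_a_merged] applies. *)
Lemma hole_pair_a w x y : x = s1 \/ x = s2 ->
  hole_pair w x y -> hole_pair (rcons w La) s1 (a y).
Proof.
move=> x12 [xy hx hy]; split; [exact/nesym/acta_neq_s1|exact: hole_s1|].
have [y1 | /eqP y1] := eqVneq y s1.
  have x2 : x = s2 by case: x12 => // x1; case: xy; rewrite x1.
  by rewrite y1 acta_s1; apply: hole_a_merged; rewrite -?y1 -?x2.
have [y2 | /eqP y2] := eqVneq y s2; last exact: hole_a.
have x1 : x = s1 by case: x12 => // x2; case: xy; rewrite x2.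
by rewrite y2; apply: hole_a_merged; rewrite -?y2 -?x1.
Qed.

Lemma hole_pair_compresses w x y :
  hole_pair w x y -> x <> s1 -> x <> s2 -> y <> s1 -> y <> s2 ->
  compresses3 A (rcons w La).
Proof.
case=> xy hx hy x1 x2 y1 y2; apply/compresses3_holes.
have uniq_xy : uniq [:: s1; a x; a y].
  rewrite /= !inE negb_or andbT -andbA.
  apply/and3P; split; apply/eqP; try exact/nesym/acta_neq_s1.
  by move/(acta_inj x1 y1).
have <- : #|[:: s1; a x; a y]| = 3 by apply/card_uniqP.
apply: subset_leq_card.
apply/subsetP => z; rewrite !inE => /or3P[] /eqP->.
- exact: hole_s1.
- exact: hole_a.
- exact: hole_a.
Qed.

(** * The conditions as equations *)

Lemma condition1E :
  condition1 s1 s2 <-> b s1 <> s1 /\ ~ (b s1 = s2 /\ b s2 = s1).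
Proof.
rewrite /condition1; have -> : act_set [set s1; s2] [:: Lb] = [set b s1; b s2].
  by rewrite /act_set imsetU1 imset_set1.
split=> [[/card_gt1P[x [y [orbx orby xy]]] ne]|[b1 ne]].
  split=> [b1|[b1 b2]]; last by apply: ne; rewrite b1 b2 setUC.
  have it n : iter n b s1 = s1 by elim: n => //= n ->.
  move: orbx orby xy; rewrite -!fconnect_orbit.
  by move=> /iter_findex <- /iter_findex <-; rewrite !it eqxx.
split.
  apply/card_gt1P; exists s1, (b s1); rewrite -!fconnect_orbit.
  by rewrite connect0 fconnect1; split=> //; apply/eqP/nesym.
move/setP=> eqs; have := eqs (b s1); have := eqs (b s2).
rewrite !inE !eqxx orbT => /esym/orP[]/eqP b2 /esym/orP[]/eqP b1' //.
- exact: ne.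
- by case: s1_neq_s2; apply: actb_inj; rewrite b1' b2.
Qed.

Lemma acta_set2_stable x y : act_set [set x; y] [:: La] = [set x; y] ->
  (a x = x \/ a x = y) /\ (a y = x \/ a y = y).
Proof.
move=> stab; have in_xy z : z \in [set x; y] -> a z = x \/ a z = y.
  move=> xy_z; apply/set2P; rewrite -stab; exact: imset_f.
by split; apply: in_xy; rewrite (set21, set22).
Qed.

Lemma acta_set2_fix x y : a x = x -> a y = y ->
  act_set [set x; y] [:: La] = [set x; y].
Proof.
move=> ax ay.
by rewrite /act_set imsetU1 imset_set1 /act /= -/(a x) -/(a y) ax ay.
Qed.

Lemma acta_set2_swap x y : a x = y -> a y = x ->
  act_set [set x; y] [:: La] = [set x; y].
Proof.
move=> ax ay; rewrite /act_set imsetU1 imset_set1 /act /= -/(a x) -/(a y) ax ay.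
exact: setUC.
Qed.

Lemma b_cycle2 x y : b_cycle [:: x; y] <-> b x = y /\ b y = x.
Proof.
rewrite /b_cycle /= andbT.
by split=> [/andP[/eqP-> /eqP->] | [-> ->]] //; rewrite !eqxx.
Qed.

Lemma b_cycle3 x y z :
  b_cycle [:: x; y; z] <-> [/\ b x = y, b y = z & b z = x].
Proof.
rewrite /b_cycle /= andbT.
by split=> [/and3P[/eqP-> /eqP-> /eqP->] | [-> -> ->]] //; rewrite !eqxx.
Qed.

Lemma b_cycle4 x y z t :
  b_cycle [:: x; y; z; t] <-> [/\ b x = y, b y = z, b z = t & b t = x].
Proof.
rewrite /b_cycle /= andbT.
by split=> [/and4P[/eqP-> /eqP-> /eqP-> /eqP->] | [-> -> -> ->]] //;
  rewrite !eqxx.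
Qed.

Lemma notin_set2 (x y z : state A) : x <> y -> x <> z -> x \notin [set y; z].
Proof. by rewrite !inE => /eqP/negPf-> /eqP/negPf->. Qed.

(** * Necessity: traps *)

(** If [x] is in [{s1, s2}] and the holes lie in [{x, y}], then after reading [a]
they lie in [{s1, a y}]: a hole [a x] other than [s1] requires that both [s1] and
[s2] were holes, so that [y] is the other one of them and [a x = a y].  Hence the
two closure hypotheses keep the holes in a pair of [F], up to its orientation. *)
Lemma trapped (F : state A -> state A -> Prop) x0 y0 :
    F x0 y0 ->
    (forall x y, F x y -> x = s1 \/ x = s2) ->
    (forall x y, F x y -> F s1 (a y)) ->
    (forall x y, F x y -> F (b x) (b y) \/ F (b y) (b x)) ->
  ~ compressible3 A.
Proof.
move=> F0 F12 Fa Fb [w /compresses3_holes].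
suff [x [y [_ sub]]] : exists x y, F x y /\
    (forall z, hole w z -> z = x \/ z = y).
  have /subset_leq_card : [set z | hole w z] \subset [set x; y].
    by apply/subsetP => z; rewrite !inE => /sub[] ->; rewrite eqxx ?orbT.
  rewrite cards2 => le /leq_trans/(_ le).
  by case: (_ != _).
elim/last_ind: w => [|w l [x [y [Fxy sub]]]].
  by exists x0, y0; split=> // z; rewrite hole_nil.
case: l.
  exists s1, (a y); split=> [|z hz]; first exact: Fa Fxy.
  have [|/eqP z1] := eqVneq z s1; [by left | right].
  have [q _ zq] := acta_surj z1.
  have pre q' : a q' = z -> q' = x \/ q' = y.
    move=> q'z; apply: sub; apply: (@hole_preimage w La).
    by rewrite -/(a q') q'z.
  have xaz : a x = z -> z = a y.
    case: (F12 x y Fxy) => xs xz.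
      case: (pre s2) => [|s2x|<-]; rewrite -?acta_s1 -?xs //.
      by case: s1_neq_s2; rewrite s2x.
    case: (pre s1) => [|s1x|<-]; rewrite ?acta_s1 -?xs //.
    by case: s1_neq_s2; rewrite s1x.
  by case: (pre q (esym zq)) => qE; [apply: xaz; rewrite -qE | rewrite zq qE].
have sub' z : hole (rcons w Lb) z -> z = b x \/ z = b y.
  have [b' _ bK] := b_perm; rewrite -[z]bK => /hole_preimage/sub[] ->.
    by left.
  by right.
case: (Fb x y Fxy) => Fb'; first by exists (b x), (b y).
by exists (b y), (b x); split=> // z /sub'[]; [right | left].
Qed.

(** The pairs with an arbitrary second entry form a trap when [b] fixes the first
entry [s1], or keeps it within [{s1, s2}]. *)
Lemma compressible3_condition1 : compressible3 A -> condition1 s1 s2.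
Proof.
move=> comp; apply/condition1E; split=> [b1 | [b1 b2]]; move: comp.
  apply: (@trapped (fun x y => x = s1) s1 s1) => //= x y xs; first by left.
  by left; rewrite xs.
apply: (@trapped (fun x y => x = s1 \/ x = s2) s1 s1) => //= [|x y _|x y x12].
- by left.
- by left.
- by left; case: x12 => ->; [right | left].
Qed.

(** Any two elements of a three-element set [{s1, s2, s3}] include [s1] or [s2],
so the pairs in this set form a trap as soon as the letters do not leave it. *)
Lemma trapped_triple s3 :
    (forall z, z \in [:: s2; s3] -> a z \in [:: s2; s3]) ->
    (forall z, z \in [:: s1; s2; s3] -> b z \in [:: s1; s2; s3]) ->
  ~ compressible3 A.
Proof.
move=> a23 b123; apply: (@trapped (fun x y =>
  [/\ x <> y, x = s1 \/ x = s2 & y \in [:: s1; s2; s3]]) s1 s2).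
- by split=> //; [left | rewrite !inE eqxx orbT].
- by move=> x y [].
- move=> x y [_ _ y123]; split; [exact/nesym/acta_neq_s1 | by left |].
  rewrite inE; apply/orP; right; move: y123; rewrite inE.
  by case/orP=> [/eqP->|/a23 //]; rewrite acta_s1 a23 // inE eqxx.
- move=> x y [xy x12 y123].
  have [bx by'] : b x \in [:: s1; s2; s3] /\ b y \in [:: s1; s2; s3].
    by split; apply: b123 => //; case: x12 => ->; rewrite !inE eqxx ?orbT.
  have bxy : b x <> b y by move/actb_inj.
  have [xE|xE|xE] : [\/ b x = s1, b x = s2 | b x = s3].
    by move: bx; rewrite !inE => /or3P[] /eqP xE; constructor.
  + by left; split=> //; left.
  + by left; split=> //; right.
  + right; split=> //; first exact: nesym.
    by move: by'; rewrite !inE -xE => /or3P[] /eqP ?; [left | right | case: bxy].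
Qed.

(** The traps are [{s1, s3}] for (a), the pairs in [{s1, s2, s3}] for (b), and the
three pairs [{s1, s3}], [{s1, b s2}], [{s2, s3}] for (c). *)
Lemma compressible3_condition2 : compressible3 A -> condition2 s1 s2.
Proof.
move=> comp; rewrite /condition2 /= => s3 _ /b_cycle2[b1 b3].
split=> [a3|a3|a3 _].
- move: comp; apply: (@trapped (fun x y => (x, y) = (s1, s3)) s1 s3) => //.
  + by move=> x y [-> _]; left.
  + by move=> x y [_ ->]; rewrite a3.
  + by move=> x y [-> ->]; rewrite b1 b3; right.
- have [b2|/eqP] := eqVneq (b s2) s2; last by left.
  right=> a2; move: comp; apply: (@trapped_triple s3) => z; rewrite !inE.
  + by case/orP=> /eqP->; rewrite ?a2 ?a3 eqxx ?orbT.
  + by case/or3P=> /eqP->; rewrite ?b1 ?b2 ?b3 eqxx ?orbT.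
- have [bb2|/eqP] := eqVneq (b (b s2)) s2; last by left.
  right=> ab2; move: comp; apply: (@trapped (fun x y =>
    [\/ (x, y) = (s1, s3), (x, y) = (s1, b s2) | (x, y) = (s2, s3)]) s1 s3).
  + by constructor.
  + by move=> x y [] [-> _]; [left | left | right].
  + move=> x y [] [_ ->]; rewrite ?a3 ?ab2.
    * by constructor 2.
    * by constructor 1.
    * by constructor 2.
  + move=> x y [] [-> ->]; rewrite ?b1 ?b3 ?bb2; right.
    * by constructor 1.
    * by constructor 3.
    * by constructor 2.
Qed.

Lemma compressible3_condition3 : compressible3 A -> condition3 s1 s2.
Proof.
move=> comp s3 _ cyc /acta_set2_stable[a2 a3].
move: comp; apply: (@trapped_triple s3) => z; rewrite !inE.
  by case/orP=> /eqP->; [case: a2 | case: a3] => ->; rewrite eqxx ?orbT.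
case: cyc => /b_cycle3[b1 b2 b3];
  by case/or3P=> /eqP->; rewrite ?b1 ?b2 ?b3 eqxx ?orbT.
Qed.

(** Here [b] exchanges [{s1, s2}] with [{s3, s4}], so the pairs with one entry in
each of these sets form a trap. *)
Lemma compressible3_condition4 : compressible3 A -> condition4 s1 s2.
Proof.
move=> comp s3 s4 _ _ _ /b_cycle4[b1 b3 b2 b4] /acta_set2_stable[a3 a4].
move: comp; apply: (@trapped (fun x y =>
  (x = s1 \/ x = s2) /\ (y = s3 \/ y = s4)) s1 s3).
- by split; left.
- by move=> x y [].
- by move=> x y [_ [] ->]; split; auto.
- by move=> x y [[] -> [] ->]; rewrite ?b1 ?b2 ?b3 ?b4; auto.
Qed.

(** * Sufficiency: the listed words *)

(** A prefix of a listed word may be used in place of the word itself, because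
further letters never decrease the number of holes. *)
Lemma stuck_pair w x y :
    ~ some_short_word_compresses3 A ->
    hole_pair w x y -> has (prefix (rcons w La)) short_words ->
  x <> s1 -> x <> s2 -> y = s1 \/ y = s2.
Proof.
move=> stuck xy /hasP[w' short /prefixP[v w'E]] x1 x2.
have [->|/eqP y1] := eqVneq y s1; first by left.
have [->|/eqP y2] := eqVneq y s2; first by right.
case: stuck; exists w' => //; rewrite w'E.
exact/compresses3_cat/(hole_pair_compresses xy).
Qed.

Lemma hole_b_s1 : hole [:: La; Lb] (b s1).
Proof. exact: (@hole_b [:: La] s1 (hole_s1 [::])). Qed.

(** Let [t = b s2], which is outside [{s1, s2}], and [p = a t], so that [ab^2a] has
the holes [{s1, p}].  Then [ab^2ab^2a] and [ab^2a^2b^2a] force [b (b p)] and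
[b (b (a p))] into [{s1, s2}].  If [p = t], then [t] is on a cycle of [b] of
length 3 or 4, settled by [ab^2abab^2a] and [ab^3ab^3a].  Otherwise [p] and [a p]
are the two states that [b^2] maps into [{s1, s2}], and the second hole of
[ab^2aba], by [ab^2abab^2a], is one of them; as [a] is injective outside [s1],
this is a configuration excluded by [condition1] or [condition3]. *)
Lemma stuck_near : ~ some_short_word_compresses3 A ->
  condition1 s1 s2 -> condition3 s1 s2 -> b s1 <> s2.
Proof.
move=> stuck /condition1E[_ c1] c3 b1; have stuckP := stuck_pair stuck.
have a12 := acta_s1.
have [b' bK b'K] := b_perm.
move t_def: (b s2) => t; move p_def: (a t) => p.
have t1 : t <> s1 by move=> t1; apply: c1; rewrite b1 t_def.
have t2 : t <> s2 by congruence.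
have p1 : p <> s1 by rewrite -p_def; apply: acta_neq_s1.
have ht : hole [:: La; Lb; Lb] t.
  by rewrite -t_def -b1; apply: (@hole_b [:: La; Lb] _ hole_b_s1).
have pair_p := hole_pair_start ht t1 t2; rewrite p_def /= in pair_p.
have pair_bp := hole_pair_b pair_p; rewrite b1 /= in pair_bp.
have pair_bbp := hole_pair_b pair_bp; rewrite t_def /= in pair_bbp.
have bbp := stuckP _ _ _ pair_bbp isT t1 t2.
have pair_q := hole_pair_a (or_introl erefl) pair_p.
have /= pair_bbq := hole_pair_b (hole_pair_b pair_q).
rewrite b1 t_def in pair_bbq.
have bbq := stuckP _ _ _ pair_bbq isT t1 t2.
(* The holes of [ab^2ab] are [s2] and [b p], whatever [b p] is. *)
have abp := hole_pair_a (or_intror erefl) pair_bp.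
have /= pair_z := hole_pair_b (hole_pair_b abp).
rewrite b1 t_def in pair_z.
have bbz := stuckP _ _ _ pair_z isT t1 t2.
have a2t : a s2 <> a t by move/(acta_inj (nesym s1_neq_s2) t1); congruence.
have t12 : t \notin [set s1; s2] by apply: notin_set2.
have [pt|/eqP pt] := eqVneq p t.
  have [bt|/eqP bt] := eqVneq (b t) s1.
    have c123 : b_cycle [:: s1; s2; t] by apply/b_cycle3; split.
    have a2 : a s2 = s2.
      by rewrite pt bt a12 in bbz; case: bbz => bba2; congruence.
    by case: (c3 t t12 (or_introl c123)); apply: acta_set2_fix; congruence.
  (* Now [b] has the cycle (s1 s2 t u) and [ab^3a] has the holes [{s1, u}]. *)
  have bbt : b (b t) = s1 by rewrite pt in bbp; case: bbp => // bbt; congruence.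
  move u_def: (b t) => u; rewrite pt u_def in bbz bbt.
  have u1 : u <> s1 by congruence.
  have u2 : u <> s2 by congruence.
  have au : a u = u.
    case: bbz => bbau; last by congruence.
    have aut : a u = a t by congruence.
    by move/(acta_inj u1 t1): aut; congruence.
  have hu : hole [:: La; Lb; Lb; Lb] u.
    by rewrite -u_def; apply: (@hole_b [:: La; Lb; Lb]).
  have /= pair_u :=
    hole_pair_b (hole_pair_b (hole_pair_b (hole_pair_start hu u1 u2))).
  rewrite au b1 t_def u_def bbt b1 in pair_u.
  by case: (stuckP _ _ _ pair_u isT u1 u2); congruence.
move s_def: (a p) => s.
rewrite s_def in bbq.
have sp : s <> p.
  move=> sp; have apt : a p = a t by congruence.
  by move/(acta_inj p1 t1): apt; congruence.
case: bbp => bbp.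
  have bbs : b (b s) = s2 by case: bbq => // bbs; congruence.
  have bs : b s = s1 by congruence.
  have bps : b p = s by congruence.
  rewrite bps in bbz.
  have ast : a s = a t -> s = t by apply: acta_inj => //; congruence.
  have asp : a s = a p -> s = p by apply: acta_inj => //; congruence.
  have st : s = t.
    apply: ast; case: bbz => bbas; first by congruence.
    by case: sp; apply: asp; congruence.
  have c123 : b_cycle [:: s1; s2; t] by apply/b_cycle3; split; congruence.
  by case: (c3 t t12 (or_introl c123)); apply: acta_set2_swap; congruence.
have bp : b p = s1 by congruence.
have bbs : b (b s) = s1 by case: bbq => // bbs; congruence.
have a2 : a s2 = s by rewrite bp a12 in bbz; case: bbz => bba2; congruence.
have : a s2 = a p by congruence.
by move/(acta_inj (nesym s1_neq_s2) p1); congruence.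
Qed.

(** Let [t = b s1], [p = a t] and [q = a p], so that [aba] and [abaa] have the
holes [{s1, p}] and [{s1, q}].  Then [ababa] and [abaaba] force [b p] and [b q]
into [{s1, s2}].  If [p = t], or if [q = t], then [a] permutes [{p, q}], and
following [b] from [s1] and [s2] either gives a configuration excluded by
[condition2], [condition3] or [condition4], or shows that one of [abab^2aba],
[ab^3aba], [abab^3a] makes three holes.  If [t], [p] and [q] are distinct, then
[b t] is outside [{s1, s2}] and [r = a (b t)] is such that [ab^2a] has the holes
[{s1, r}]; the words through it force both [b r = s2] and [b p = s2], whereas
[r] and [p] are different. *)
Lemma stuck_far : ~ some_short_word_compresses3 A ->
    condition2 s1 s2 -> condition3 s1 s2 -> condition4 s1 s2 ->
    b s1 <> s1 -> b s1 <> s2 ->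
  False.
Proof.
rewrite /condition2 /condition4 /= => stuck c2 c3 c4 + +.
have stuckP := stuck_pair stuck.
have a12 := acta_s1.
have [b' bK b'K] := b_perm.
move t_def: (b s1) => t; move p_def: (a t) => p; move q_def: (a p) => q t1 t2.
have t12 : t \notin [set s1; s2] by apply: notin_set2.
have p1 : p <> s1 by rewrite -p_def; apply: acta_neq_s1.
have q1 : q <> s1 by rewrite -q_def; apply: acta_neq_s1.
have qp : q = p -> p = t.
  by move=> qp; apply: acta_inj => //; congruence.
have ht : hole [:: La; Lb] t by rewrite -t_def; apply: hole_b_s1.
have pair_p := hole_pair_start ht t1 t2; rewrite p_def /= in pair_p.
have pair_bp := hole_pair_b pair_p; rewrite t_def /= in pair_bp.
have bp := stuckP _ _ _ pair_bp isT t1 t2.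
have pair_q := hole_pair_a (or_introl erefl) pair_p; rewrite q_def /= in pair_q.
have pair_bq := hole_pair_b pair_q; rewrite t_def /= in pair_bq.
have bq := stuckP _ _ _ pair_bq isT t1 t2.
have pair_bbp := hole_pair_b pair_bp; rewrite /= in pair_bbp.
have [pt|/eqP pt] := eqVneq p t.
  (* [condition2] leaves [b t = s2], so that [abab^2] has the holes [s2] and
     [b s2]; [abab^2aba] and then [abab^3a] decide where [b s2] is. *)
  have bt : b t = s2.
    rewrite pt in bp; case: bp => // bt.
    have c13 : b_cycle [:: s1; t] by apply/b_cycle2.
    by case: (c2 t t12 c13); congruence.
  rewrite pt bt in pair_bbp.
  have abbp := hole_pair_a (or_intror erefl) pair_bbp; rewrite /= in abbp.
  have /= pair_z := hole_pair_b abbp; rewrite t_def in pair_z.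
  have bz := stuckP _ _ _ pair_z isT t1 t2.
  have [b2|/eqP b2] := eqVneq (b s2) s1.
    have c132 : b_cycle [:: s1; t; s2] by apply/b_cycle3.
    have a2 : a s2 = s2.
      rewrite b2 a12 in bz; case: bz => ba2; first by congruence.
      have a2t : a s2 = a t by congruence.
      by move/(acta_inj (nesym s1_neq_s2) t1): a2t; congruence.
    by case: (c3 t t12 (or_intror c132)); apply: acta_set2_fix; congruence.
  move f_def: (b s2) => f; rewrite f_def in bz b2 pair_bbp.
  have f2 : f <> s2 by congruence.
  have /= pair_bbbp := hole_pair_b (hole_pairC pair_bbp).
  rewrite f_def in pair_bbbp.
  have bf : b f = s1.
    case: (stuckP _ _ _ (hole_pairC pair_bbbp) isT b2 f2) => // bf.
    by congruence.
  have c1324 : b_cycle [:: s1; t; s2; f] by apply/b_cycle4.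
  have aft : a f = a t -> f = t by apply: acta_inj.
  have f12 : f \notin [set s1; s2] by apply: notin_set2.
  case: (c4 t f t12 f12 _ c1324); first by congruence.
  apply: acta_set2_fix; first by congruence.
  case: bz => baf; first by congruence.
  have: f = t by apply: aft; congruence.
  by congruence.
(* From here on, [{p, q}] is the preimage of [{s1, s2}] under [b]. *)
have in_pq z : b z = s1 \/ b z = s2 -> z = p \/ z = q.
  case: (bp) (bq) => [bp'|bp'] [bq'|bq'] [bz|bz]; try by left; congruence.
  - by case: pt; apply: qp; congruence.
  - by right; congruence.
  - by right; congruence.
  - by case: pt; apply: qp; congruence.
have [qt|/eqP qt] := eqVneq q t.
  rewrite qt in bq.
  case: bq => bt.
    have c13 : b_cycle [:: s1; t] by apply/b_cycle2.
    have bp2 : b p = s2 by case: bp => // bp; congruence.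
    have [c2a c2b c2c] := c2 t t12 c13.
    have p2 : p <> s2 by move=> p2; case: c2b; congruence.
    have b2p : b s2 <> p.
      move=> b2p; have b2_2t : b s2 \notin [set s2; t].
        by apply: notin_set2; congruence.
      by case: (c2c _ b2_2t); congruence.
    (* The pair [{s1, p}] left by [aba] becomes [{t, b (b s2)}] under [b^3]. *)
    rewrite bt bp2 in pair_bbp.
    have /= pair_bbbp := hole_pair_b pair_bbp; rewrite t_def in pair_bbbp.
    have bb2 := stuckP _ _ _ pair_bbbp isT t1 t2.
    by case: (in_pq _ bb2); congruence.
  have bp1 : b p = s1 by case: bp => // bp; congruence.
  have p2 : p <> s2.
    move=> p2; have c132 : b_cycle [:: s1; t; s2].
      by apply/b_cycle3; split; congruence.
    by case: (c3 t t12 (or_intror c132)); apply: acta_set2_swap; congruence.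
  move f_def: (b s2) => f.
  have fp : f <> p.
    move=> fp; have c1324 : b_cycle [:: s1; t; s2; p].
      by apply/b_cycle4; split; congruence.
    have p12 : p \notin [set s1; s2] by apply: notin_set2.
    case: (c4 t p t12 p12 _ c1324); first by congruence.
    by apply: acta_set2_swap; congruence.
  (* The fourth state on the cycle of [b] through [s1] is new, and [ab^3aba]
     applies to it. *)
  have f1 : f <> s1 by congruence.
  have f2 : f <> s2 by congruence.
  have hf : hole [:: La; Lb; Lb; Lb] f.
    rewrite -f_def -bt; apply: (@hole_b [:: La; Lb; Lb]).
    exact: (@hole_b [:: La; Lb]).
  have /= pair_f := hole_pair_b (hole_pair_start hf f1 f2).
  rewrite t_def in pair_f.
  have bf := stuckP _ _ _ pair_f isT t1 t2.
  have aft : a f = a t -> f = t by apply: acta_inj.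
  have afp : a f = a p -> f = p by apply: acta_inj.
  case: (in_pq _ bf) => af; last by apply: fp; apply: afp; congruence.
  by have: f = t by [apply: aft; congruence]; congruence.
have bt12 : ~ (b t = s1 \/ b t = s2) by move/in_pq; case; congruence.
move c_def: (b t) => c; move r_def: (a c) => r; rewrite c_def in bt12 pair_bbp.
have c1 : c <> s1 by move=> ?; apply: bt12; left.
have c2' : c <> s2 by move=> ?; apply: bt12; right.
have hc : hole [:: La; Lb; Lb] c by rewrite -c_def; apply: (@hole_b [:: La; Lb]).
have pair_r := hole_pair_start hc c1 c2'; rewrite r_def /= in pair_r.
have pair_br := hole_pair_b pair_r; rewrite t_def /= in pair_br.
have br := stuckP _ _ _ pair_br isT t1 t2.
have pair_bbr := hole_pair_b pair_br; rewrite c_def /= in pair_bbr.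
have bbr := in_pq _ (stuckP _ _ _ pair_bbr isT c1 c2').
(* [b r] is in both [{s1, s2}] and [{p, q}], by [ab^2aba] and [ab^2ab^2a]; but
   [s1] is not a value of [a], hence not in [{p, q}]. *)
have br2 : b r = s2 by case: br => // br; case: bbr; congruence.
(* The holes [s2] and [t] of [ab^2ab] become [s1] and [p]: the same argument
   applies to [p] through [ab^2abab^2a]. *)
have /= pair_p' := hole_pair_a (or_intror br2) (hole_pairC pair_br).
have /= pair_bbp' := hole_pair_b (hole_pair_b pair_p').
rewrite t_def c_def p_def in pair_bbp'.
have bbp := in_pq _ (stuckP _ _ _ pair_bbp' isT c1 c2').
have bp2 : b p = s2 by case: bp => // bp; case: bbp; congruence.
have act : a c = a t -> c = t by apply: acta_inj.
have ct : c = t by apply: act; congruence.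
by congruence.
Qed.

Lemma conditions_some_short_word :
    condition1 s1 s2 -> condition2 s1 s2 -> condition3 s1 s2 ->
    condition4 s1 s2 ->
  some_short_word_compresses3 A.
Proof.
move=> c1 c2 c3 c4.
have [/hasP[w short comp]|/hasPn none] := boolP (has (fun w =>
  3 <= #|state A| - #|act_set [set: state A] w|) short_words).
  by exists w.
have stuck : ~ some_short_word_compresses3 A.
  by move=> [w /none/negP].
have [b1 _] := (condition1E.1 c1).
by case: (stuck_far stuck c2 c3 c4 b1 (stuck_near stuck c1 c3)).
Qed.

(** * Properness *)

Lemma card_holes w : #|[set x | hole w x]| <= count_mem La w.
Proof.
elim/last_ind: w => [|w l IHw].
  by rewrite eq_card0 // => x; rewrite inE hole_nil.
rewrite -cats1 count_cat /= addn0 cats1.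
case: l.
  apply: (@leq_trans #|s1 |: [set a x | x in [set x | hole w x]]|).
    apply/subset_leq_card/subsetP => z; rewrite !inE.
    have [//|/eqP z1] := eqVneq z s1.
    have [y _ ->] := acta_surj z1.
    by move/hole_preimage => hy; apply: imset_f; rewrite inE.
  rewrite cardsU1 addnC leq_add //; last by case: (_ \notin _).
  exact: leq_trans (leq_imset_card _ _) IHw.
rewrite addn0; apply: leq_trans IHw.
apply: leq_trans (leq_imset_card b _).
apply/subset_leq_card/subsetP => z; have [b' _ bK] := b_perm.
by rewrite inE -[z]bK => /hole_preimage hz; apply: imset_f; rewrite inE.
Qed.

(** [a] permutes the states other than [s1]. *)
Lemma hole_nseq_a k z : hole (nseq k La) z -> z = s1.
Proof.
elim: k z => [|k IHk] z; first by rewrite hole_nil.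
have [//|/eqP z1] := eqVneq z s1; have [y y1 ->] := acta_surj z1.
have -> : nseq k.+1 La = rcons (nseq k La) La.
  by rewrite -cats1 -(nseqD k 1) addn1.
by move/hole_preimage/IHk.
Qed.

Lemma compresses3_size3 w : size w = 3 -> ~ compresses3 A w.
Proof.
move=> size_w /compresses3_holes comp.
have /all_pred1P w_aaa : all (pred1 La) w.
  rewrite all_count eqn_leq count_size size_w.
  exact: leq_trans comp (card_holes w).
move: comp; rewrite w_aaa; apply/negP; rewrite -ltnNge ltnS.
apply: (@leq_trans #|[set s1]|); last by rewrite cards1.
apply/subset_leq_card/subsetP => z; rewrite inE in_set1.
by move/hole_nseq_a ->.
Qed.

End Automaton.

Theorem proposition10 (A : automaton) (s1 s2 : state A)
    (s1_neq_s2 : s1 <> s2)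
    (b_perm : bijective (@actb A))
    (a_type : a_of_type s1 s2 s1) :
  let conditions :=
    [/\ condition1 s1 s2, condition2 s1 s2, condition3 s1 s2
      & condition4 s1 s2] in
  [/\ compressible3 A <-> conditions,
      proper_compressible3 A <-> conditions
    & compressible3 A -> some_short_word_compresses3 A].
Proof.
move=> conditions.
have necessary : compressible3 A -> conditions.
  move=> comp; split.
  - exact: compressible3_condition1.
  - exact: compressible3_condition2.
  - exact: compressible3_condition3.
  - exact: compressible3_condition4.
have short : conditions -> some_short_word_compresses3 A.
  by case; apply: conditions_some_short_word.
have sufficient : conditions -> compressible3 A.
  by move/short => [w _ comp]; exists w.
split; last by move/necessary/short.
  by split.
split=> [[/necessary] // | /sufficient comp]; split=> // w.
exact: compresses3_size3 s1_neq_s2 b_perm a_type w.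
Qed.
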